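(* Let $G$ be a finite group, let $a\in G$ be anticentral, and set $D=\mathbf{C}^{\infty}(a)$. Then: (i) $D$ is a nilpotent subgroup of $G$ with $\mathbf{N}_G(D)=D$; (ii) $G = DG'$; (iii) every subgroup $H\leq G$ with $HG'=G$ and $a\in H$ contains $D$; (iv) every nilpotent subgroup of $G$ containing $a$ is contained in $D$; (v) $D$ is the only nilpotent subgroup $H$ of $G$ with $HG'=G$ and $a\in H$.
   Context: $G'$ is the commutator subgroup of $G$. An element $a\in G$ is anticentral (in $G$) if $|\mathbf{C}_G(a)| = |G:G'|$. Commutators are $[g,x]=g^{-1}x^{-1}gx$. For $g\in G$, define subsets $\mathbf{C}^i(g)\subseteq G$ inductively by $\mathbf{C}^0(g)=\{1\}$ and $\mathbf{C}^{i+1}(g)=\{x\in G \mid [g,x]\in \mathbf{C}^i(g)\}$, and put $\mathbf{C}^{\infty}(g)=\bigcup_{i\geq 0}\mathbf{C}^i(g)$. *)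

(* Defs.v *)
From mathcomp Require Import all_boot all_fingroup all_solvable.

Set Implicit Arguments.
Unset Strict Implicit.
Unset Printing Implicit Defensive.

Import GroupScope.

Section Definitions.

Variables (gT : finGroupType) (G : {set gT}).

Definition anticentral (a : gT) : bool :=
  (a \in G) && (#|'C_G[a]| == #|G : G^`(1)|).

(* [~ g, x] is g^-1 * (x^-1 * (g * x)). *)
Fixpoint centn (g : gT) (i : nat) : {set gT} :=
  if i is j.+1 then [set x in G | [~ g, x] \in centn g j] else 1.

(* The union over all i : nat, truncated at #|G| so as to be a {set gT};
   centooP shows that nothing is lost when G is a group. *)
Definition centoo (g : gT) : {set gT} := \bigcup_(i < #|G|.+1) centn g i.

End Definitions.

Section CentooP.

Variables (gT : finGroupType) (G : {group gT}) (g : gT).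

Lemma centn_sub i : centn G g i \subset G.
Proof.
case: i => [|i]; first exact: sub1G.
by apply/subsetP=> x; rewrite inE => /andP[].
Qed.

Lemma centn_subS i : centn G g i \subset centn G g i.+1.
Proof.
elim: i => [|i IHi]; apply/subsetP=> x.
  by move/set1P->; rewrite !inE group1 commg1 eqxx.
rewrite inE => /andP[Gx gx]; rewrite inE Gx /=.
exact: (subsetP IHi).
Qed.

Lemma centn_mono i j : i <= j -> centn G g i \subset centn G g j.
Proof.
move/subnK<-; elim: (j - i) => [|k IHk] //.
exact: subset_trans IHk (centn_subS _).
Qed.

Lemma centn_stable i : centn G g i = centn G g i.+1 ->
  forall j, i <= j -> centn G g j = centn G g i.
Proof.
move=> eqi j /subnK<-; elim: (j - i) => [|k IHk] //.
by rewrite addSn /= IHk [RHS]eqi.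
Qed.

Lemma centn_bound i : centn G g i \subset centn G g #|G|.
Proof.
have [/centn_mono // | /ltnW leGi] := leqP i #|G|.
suff [k lek eqk] : exists2 k, k <= #|G| & centn G g k = centn G g k.+1.
  by rewrite (centn_stable eqk (leq_trans lek leGi)) centn_mono.
have [/existsP[k /eqP eqk] | /existsPn neq] :=
    boolP [exists k : 'I_#|G|.+1, centn G g k == centn G g k.+1].
  by exists k; rewrite // -ltnS.
have card_gt k : k <= #|G|.+1 -> k < #|centn G g k|.
  elim: k => [|k IHk] lek; first by rewrite cards1.
  apply: leq_ltn_trans (IHk (ltnW lek)) (proper_card _).
  by rewrite properEneq (neq (Ordinal lek)) centn_subS.
have := card_gt _ (leqnn _); rewrite ltnNge => /negP[].
exact: leq_trans (subset_leq_card (centn_sub _)) (leqnSn _).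
Qed.

Lemma centooP x : reflect (exists i, x \in centn G g i) (x \in centoo G g).
Proof.
apply: (iffP bigcupP) => [[i _ Cx] | [i Cx]]; first by exists i.
by exists ord_max => //; apply: subsetP Cx; apply: centn_bound.
Qed.

End CentooP.

(* Main.v *)
Require Import Defs.
From mathcomp Require Import all_boot all_fingroup all_solvable.

Set Implicit Arguments.
Unset Strict Implicit.
Unset Printing Implicit Defensive.

Import GroupScope.

(** An element [a] is anticentral iff its class is the whole coset [a *: G'].
    Comparing class sizes, [a] stays anticentral in every supplement [H] of
    [G'] containing [a], and such an [H] contains ['C_G[a]]; hence [x \in H] as
    soon as [[~ a, x] \in H], which puts [D] inside [H] and makes [H]
    self-normalizing.  If [G] has no proper supplement of [G'] through [a],
    then for every Sylow subgroup [P] the Frattini argument makes ['N_G(P)] a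
    supplement, a conjugate of which contains [a]; so ['N_G(P) = G], and [G] is
    nilpotent.  By induction some nilpotent supplement [K] contains [a].
    Nilpotent subgroups through [a] lie in [D] by their upper central series,
    so [K = D]. *)

(** The Sylow subgroups generate [G], and each, being normal and nilpotent, lies in the Fitting
    subgroup. *)
Lemma nilpotent_normal_Sylow (gT : finGroupType) (G : {group gT}) :
  (forall P : {group gT}, Sylow G P -> P <| G) -> nilpotent G.
Proof.
move=> nsSylG; suffices <-: 'F(G) = G by apply: Fitting_nil.
apply/eqP; rewrite eqEsubset Fitting_sub -{1}(Sylow_gen G) gen_subG.
apply/bigcupsP=> P sylP; apply: Fitting_max; first exact: nsSylG.
by have [p _ /pHall_pgroup/pgroup_nil] := SylowP _ _ sylP.
Qed.

(** The product P G' is normal because it contains G', so the Frattini argument applies to it; the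
    factor [P] is absorbed by its normalizer. *)
Lemma Frattini_der1 (gT : finGroupType) (G P : {group gT}) p :
  p.-Sylow(G) P -> 'N_G(P) * G^`(1) = G.
Proof.
move=> sylP; have sPG := pHall_sub sylP.
have nG'G : G \subset 'N(G^`(1)) := der_norm 1 G.
have nsKG : P <*> G^`(1) <| G.
  by rewrite sub_der1_normal ?joing_subr // join_subG sPG der_sub.
have sylPK := pHall_subl (joing_subl P G^`(1)) (normal_sub nsKG) sylP.
rewrite -[RHS](Frattini_arg nsKG sylPK) /= norm_joinEl; last first.
  exact: subset_trans sPG nG'G.
have nG'N : 'N_G(P) \subset 'N(G^`(1)) by rewrite subIset ?nG'G.
have /mulSGid PN : P \subset 'N_G(P) by rewrite subsetI sPG normG.
by rewrite -mulgA -(normC nG'N) mulgA PN.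
Qed.

Section Centoo.

Variables (gT : finGroupType) (G : {group gT}) (a : gT).

Lemma centoo_sub : centoo G a \subset G.
Proof. by apply/bigcupsP=> i _; apply: centn_sub. Qed.

Lemma centoo_min (A : {set gT}) :
  1 \in A -> (forall x, x \in G -> [~ a, x] \in A -> x \in A) ->
  centoo G a \subset A.
Proof.
move=> A1 closedA; apply/subsetP=> x /centooP[i].
elim: i x => [x /set1P-> // | i IHi x].
by rewrite inE => /andP[Gx /IHi]; apply: closedA.
Qed.

Lemma sub_nil_centoo (H : {group gT}) :
  H \subset G -> nilpotent H -> a \in H -> H \subset centoo G a.
Proof.
move=> sHG /ucnP[n defH] Ha.
suffices sZC i : 'Z_i(H) \subset centn G a i.
  apply/subsetP=> x; rewrite -defH => /(subsetP (sZC n)) Cx.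
  by apply/centooP; exists n.
elim: i => [|i IHi]; first by rewrite ucn0.
apply/subsetP=> x Zx; have Hx := subsetP (ucn_sub _ _) x Zx.
rewrite inE (subsetP sHG) //=.
apply/(subsetP IHi)/(subsetP (ucn_comm i H)).
by rewrite commGC mem_commg.
Qed.

End Centoo.

Section Anticentral.

Variables (gT : finGroupType) (a : gT).
Implicit Types G H : {group gT}.

Lemma class_sub_der1 G : a \in G -> a ^: G \subset a *: G^`(1).
Proof.
move=> Ga; apply/subsetP=> _ /imsetP[x Gx ->].
by rewrite mem_lcoset -commgEl mem_commg.
Qed.

(** The order of [G] is both |C_G(a)| |a^G| and |G:G'| |G'|, so anticentrality says that the class
    of [a], which always lies in a G', has |G'| elements. *)
Lemma anticentral_class G :
  anticentral G a = (a \in G) && (a ^: G == a *: G^`(1)).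
Proof.
rewrite /anticentral; case Ga: (a \in G) => //=.
rewrite eqEcard class_sub_der1 //= card_lcoset.
have := Lagrange (der_sub 1 G); have := Lagrange (subsetIl G 'C[a]).
rewrite index_cent1 => <- eqG.
have leG : #|a ^: G| <= #|G^`(1)|.
  by rewrite -(card_lcoset _ a) subset_leq_card ?class_sub_der1.
have C_gt0 : 0 < #|'C_G[a]| by apply: cardG_gt0.
have D_gt0 : 0 < #|G^`(1)| by apply: cardG_gt0.
apply/eqP/idP => [eqC | geG].
  by rewrite -(leq_pmul2l C_gt0) -eqG -eqC mulnC.
have eqD : #|a ^: G| = #|G^`(1)| by apply/eqP; rewrite eqn_leq leG.
by apply/eqP; rewrite -(eqn_pmul2l D_gt0) eqG eqD mulnC.
Qed.

Section Supplement.

Variables G H : {group gT}.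
Hypotheses (acGa : anticentral G a) (sHG : H \subset G).
Hypotheses (defG : H * G^`(1) = G) (Ha : a \in H).

Lemma anticentral_supplement :
  [/\ anticentral H a, 'C_G[a] \subset H & H^`(1) = H :&: G^`(1)].
Proof.
have [Ga /eqP cardC] := andP acGa.
have sCHG : 'C_H[a] \subset 'C_G[a] by rewrite setSI.
have sder : H^`(1) \subset H :&: G^`(1) by rewrite subsetI der_sub dergS.
have cardHC : (#|'C_H[a]| * #|a ^: H|)%N = #|H|.
  by rewrite -index_cent1 Lagrange ?subsetIl.
have cardH : (#|'C_G[a]| * #|H :&: G^`(1)|)%N = #|H|.
  apply/eqP; rewrite -(eqn_pmul2r (cardG_gt0 G^`(1))) mul_cardG defG.
  by rewrite -(Lagrange (der_sub 1 G)) -cardC mulnAC [(#|'C_G[a]| * _)%N]mulnC.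
have lecl : #|a ^: H| <= #|H^`(1)|.
  by rewrite -(card_lcoset _ a) subset_leq_card ?class_sub_der1.
(* The product |C_H(a)| |a^H| is bounded factorwise by |C_G(a)| |H :&: G'|; both equal |H| > 0, so
   the factors agree. *)
have [_] := leqif_mul (subset_leqif_cards sCHG)
  (leqif_eq (leq_trans lecl (subset_leq_card sder))).
rewrite cardH cardHC eqxx eqn0Ngt cardG_gt0 /=.
case/esym/andP=> /eqP eqC /eqP eqcl.
have defH' : H^`(1) = H :&: G^`(1).
  by apply/eqP; rewrite eqEcard sder -eqcl.
split=> //; last by rewrite -eqC subsetIl.
rewrite anticentral_class Ha eqEcard class_sub_der1 //=.
by rewrite card_lcoset defH' eqcl.
Qed.

(** The conjugate a^x = a [a, x] lies in a (H :&: G') = a H', the class of [a] in [H]. So a^x = a^h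
    with [h] in [H], and x h^-1 centralizes [a], hence lies in [H]. *)
Lemma supplement_commg_mem x : x \in G -> [~ a, x] \in H -> x \in H.
Proof.
move=> Gx Hax; have [acHa sCH defH'] := anticentral_supplement.
have: a ^ x \in a ^: H.
  move: acHa; rewrite anticentral_class Ha => /eqP->.
  by rewrite mem_lcoset -commgEl defH' inE Hax mem_commg ?(subsetP sHG a Ha).
case/imsetP=> h Hh eqax; rewrite -(mulgKV h x) groupM // (subsetP sCH) //.
rewrite inE groupM ?groupV ?(subsetP sHG h Hh) //=.
by rewrite cent1C; apply/cent1P/commgP/conjg_fixP; rewrite conjgM eqax conjgK.
Qed.

End Supplement.

Lemma nilpotent_supplement G : anticentral G a ->
  exists H : {group gT},
    [/\ H \subset G, nilpotent H, H * G^`(1) = G & a \in H].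
Proof.
have [n] := ubnP #|G|; elim: n G => // n IHn G leGn acGa.
have [/existsP[H /and3P[prHG /eqP defG Ha]] | /existsPn noH] :=
    boolP [exists H : {group gT},
             [&& H \proper G, H * G^`(1) == G & a \in H]].
  have sHG := proper_sub prHG.
  have [acHa _ _] := anticentral_supplement acGa sHG defG Ha.
  have [K [sKH nilK defH Ka]] := IHn H (leq_trans (proper_card prHG) leGn) acHa.
  exists K; split=> //; first exact: subset_trans sHG.
  (* Since H' lies in G', K G' = K H' G' = H G' = G. *)
  by rewrite -(mulSGid (dergS 1 sHG)) mulgA defH.
have := acGa; rewrite anticentral_class => /andP[Ga /eqP clG].
exists G; split=> //; last exact: mulGSid (der_sub 1 G).
apply: nilpotent_normal_Sylow => P /SylowP[p _ sylP].
have defG := Frattini_der1 sylP.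
(* Modulo G', [a] agrees with some [y] normalizing [P]; as a G' is the class of [a], this [y] is a
   conjugate of [a]. *)
have [y Ny [x Gx def_y]] :
    exists2 y, y \in 'N_G(P) & exists2 x, x \in G & y = a ^ x.
  have: a \in 'N_G(P) * G^`(1) by rewrite defG.
  case/mulsgP=> y g Ny Gg def_a; exists y => //; apply/imsetP.
  by rewrite -/(a ^: G) clG mem_lcoset def_a invMg mulgKV groupV.
have sNG : 'N_G(P) :^ x^-1 \subset G.
  by rewrite -{2}(conjGid (groupVr Gx)) conjSg subsetIl.
have := noH ('N_G(P) :^ x^-1)%G; rewrite properE sNG /=.
have -> : 'N_G(P) :^ x^-1 * G^`(1) == G.
  rewrite -{1}(normsP (der_norm 1 G) x^-1) ?groupV // -conjsMg defG.
  by rewrite conjGid ?groupV.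
(* This conjugate of the normalizer contains [a], so it cannot be proper; conjugating back, [G]
   normalizes [P]. *)
rewrite mem_conjgV -def_y Ny /= andbT negbK => sGN.
rewrite /normal (pHall_sub sylP) /= -(conjGid Gx).
by rewrite sub_conjg (subset_trans sGN) // conjSg subsetIr.
Qed.

End Anticentral.

Theorem theorem3p9 (gT : finGroupType) (G : {group gT}) (a : gT)
    (D := centoo G a) (anticentral_a : anticentral G a) :
  [/\ (* (i) *)
      [/\ group_set D, D \subset G, nilpotent D & 'N_G(D) = D],
      (* (ii) *)
      G = D * G^`(1) :> {set gT},
      (* (iii) *)
      forall H : {group gT},
        H \subset G -> H * G^`(1) = G -> a \in H -> D \subset H,
      (* (iv) *)
      forall H : {group gT},
        H \subset G -> nilpotent H -> a \in H -> H \subset D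
    & (* (v) *)
      forall H : {group gT},
        [/\ H \subset G, nilpotent H, H * G^`(1) = G & a \in H]
        <-> H = D :> {set gT}].
Proof.
have minD (H : {group gT}) :
    H \subset G -> H * G^`(1) = G -> a \in H -> D \subset H.
- move=> sHG defG Ha; apply: centoo_min => // x.
  exact: supplement_commg_mem.
have [K [sKG nilK defG Ka]] := nilpotent_supplement anticentral_a.
(* So far [D] is only a set; its group structure comes from this equality. *)
have defD : D = K.
  by apply/eqP; rewrite eqEsubset minD // sub_nil_centoo.
split=> //; first split; rewrite ?centoo_sub ?defD ?groupP //.
- apply/eqP; rewrite eqEsubset subsetI sKG normG /= andbT.
  apply/subsetP=> x /setIP[Gx nKx].
  (* As [x] normalizes [K], [a, x] = a^-1 a^x lies in [K]. *)
  apply: (supplement_commg_mem anticentral_a) => //.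
  by rewrite commgEl groupM ?groupV // memJ_norm.
- by move=> H; rewrite -defD; apply: sub_nil_centoo.
move=> H; split=> [[sHG nilH defHG Ha] | -> //].
by apply/eqP; rewrite -defD eqEsubset minD // sub_nil_centoo.
Qed.
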